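(* Suppose Assumption A holds and Assumption B holds for some $p\ge2$. Let $\{(x^k,m^k)\}_{k\ge0}$ be generated by Algorithm 1 with $q=p-1$, step sizes $\{\eta_k\}_{k\ge0}$, and parameters satisfying, for all $k\ge0$, $\sum_{t=1}^{p-1}\theta_{k,t}/\gamma_{k,t}^{j}=1$ for $j=1,\dots,p-1$ and $\sum_{t=1}^{p-1}\theta_{k,t}\in(0,1)$. Let $\{p_k\}_{k\ge0}$ be a positive sequence with \[ \Big(1-\sum_{t=1}^{p-1}\theta_{k,t}\Big)p_{k+1}\le\Big(1-\frac{1}{p+1}\sum_{t=1}^{p-1}\theta_{k,t}\Big)p_k\qquad\forall k\ge0, \] and define $P_k=f(x^k)+p_k\|m^k-\nabla f(x^k)\|^2$. Then for all $k\ge0$, \[ \mathbb{E}_{\xi^{k+1}}[P_{k+1}]\le P_k-\eta_k\|\nabla f(x^k)\|+\frac{L_1}{2}\eta_k^2+\frac{(p+1)\eta_k^2}{p_k\sum_{t=1}^{p-1}\theta_{k,t}}+\frac{pL_p^2\eta_k^{2p}p_{k+1}}{(p!)^2\sum_{t=1}^{p-1}\theta_{k,t}}\Big(1+\sum_{t=1}^{p-1}\frac{\theta_{k,t}^2}{\gamma_{k,t}^{2p}}\Big)+(p-1)\sigma^2p_{k+1}\sum_{t=1}^{p-1}\theta_{k,t}^2 . \]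
   Context: Problem: minimize $f:\mathbb{R}^n\to\mathbb{R}$, where only a stochastic gradient estimator $G(\cdot;\xi)$ is accessible, $\xi$ being a random variable with sample space $\Xi$. $\|\cdot\|$ is the Euclidean norm. Assumption A: (a) there is a finite $f_{\mathrm{low}}$ with $f(x)\ge f_{\mathrm{low}}$ for all $x$; (b) there is $L_1>0$ with $\|\nabla f(y)-\nabla f(x)\|\le L_1\|y-x\|$ for all $x,y$; (c) $\mathbb{E}_\xi[G(x;\xi)]=\nabla f(x)$ and $\mathbb{E}_\xi[\|G(x;\xi)-\nabla f(x)\|^2]\le\sigma^2$ for all $x$, for some $\sigma>0$. Assumption B: $f$ is $p$ times continuously differentiable for some $p\ge2$ and there is $L_p>0$ with $\|D^pf(y)-D^pf(x)\|_{(p)}\le L_p\|y-x\|$ for all $x,y$, where $D^pf(x)$ is the $p$th derivative as a symmetric $p$-linear form and $\|\mathcal{T}\|_{(p)}=\max\{\mathcal{T}[h_1,\dots,h_p]:\|h_i\|\le 1\}$. Algorithm 1 (SFOM with multi-extrapolated momentum): inputs $x^0\in\mathbb{R}^n$, step sizes $\eta_k>0$, an integer $q\ge1$, extrapolation parameters $\gamma_{k,t}\in(0,1)$ and weighting parameters $\theta_{k,t}\in\mathbb{R}$ ($1\le t\le q$, $k\ge0$) with $\sum_{t=1}^q\theta_{k,t}\in(0,1)$ for all $k\ge0$. Initialize $x^{-1}=x^0$, $m^{-1}=0$, $(\gamma_{-1,t},\theta_{-1,t})=(1,1/q)$ for all $t$. For $k=0,1,2,\dots$: $z^{k,t}=x^k+\frac{1-\gamma_{k-1,t}}{\gamma_{k-1,t}}(x^k-x^{k-1})$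 for $1\le t\le q$; $m^k=(1-\sum_{t=1}^q\theta_{k-1,t})m^{k-1}+\sum_{t=1}^q\theta_{k-1,t}G(z^{k,t};\xi^k)$; $x^{k+1}=x^k-\eta_k m^k/\|m^k\|$. Here $\xi^0,\xi^1,\dots$ are independent samples of $\xi$ (and $m^k\neq0$ is implicitly assumed). $\mathbb{E}_{\xi^{k+1}}[\cdot]$ denotes expectation with respect to $\xi^{k+1}$ conditional on $\xi^0,\dots,\xi^k$. *)

(* Defs.v *)
From HB Require Import structures.
From mathcomp Require Import all_boot all_order all_algebra.
From mathcomp Require Import all_classical all_reals all_analysis.
Set Implicit Arguments. Unset Strict Implicit. Unset Printing Implicit Defensive.
Import Order.TTheory GRing.Theory Num.Theory.
Import numFieldNormedType.Exports.
Local Open Scope ring_scope.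

Section Defs.
Variables (R : realType) (n : nat).
Notation V := 'rV[R]_n.

Definition enorm (v : V) : R := Num.sqrt (\sum_(i < n) v 0 i ^+ 2).

Definition grad (f : V -> R) (x : V) : V :=
  \row_(i < n) ('D_(delta_mx 0 i : V) f x).

(* Iterated directional derivative:
   iter_dirder [:: h1; ...; hj] f x = D^j f(x)[h1, ..., hj]. *)
Fixpoint iter_dirder (hs : seq V) (f : V -> R) : V -> R :=
  match hs with
  | [::] => f
  | h :: hs' => fun x => 'D_h (iter_dirder hs' f) x
  end.

Definition Cp (p : nat) (f : V -> R) : Prop :=
  (forall hs : seq V, (size hs < p)%N -> forall x, differentiable (iter_dirder hs f) x)
  /\ (forall hs : seq V, (size hs <= p)%N -> continuous (iter_dirder hs f)).

End Defs.

Section Algo.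
Variables (R : realType) (n : nat) (d : measure_display) (Xi : measurableType d).
Notation V := 'rV[R]_n.
Variables (q : nat) (G : V -> Xi -> V) (x0 : V) (eta : nat -> R)
  (gam theta : nat -> 'I_q -> R).

(* parameters (gamma_{k-1,t}, theta_{k-1,t}) used at iteration k,
   with (gamma_{-1,t}, theta_{-1,t}) = (1, 1/q) *)
Definition gam_prev (k : nat) (t : 'I_q) : R :=
  if k is k'.+1 then gam k' t else 1.
Definition theta_prev (k : nat) (t : 'I_q) : R :=
  if k is k'.+1 then theta k' t else q%:R^-1.

Definition sfom_step (k : nat) (xk xkm1 mkm1 : V) (s : Xi) : V * V :=
  let z := fun t : 'I_q => xk + ((1 - gam_prev k t) / gam_prev k t) *: (xk - xkm1) in
  let m := (1 - \sum_(t < q) theta_prev k t) *: mkm1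
           + \sum_(t < q) theta_prev k t *: G (z t) s in
  (m, xk - (eta k / enorm m) *: m).

(* traj xi k = (x^k, x^{k-1}, m^{k-1}) along the sample path xi,
   with x^{-1} = x^0 and m^{-1} = 0. *)
Fixpoint traj (xi : nat -> Xi) (k : nat) : V * V * V :=
  match k with
  | 0 => (x0, x0, 0)
  | k'.+1 =>
      let: (xk, xkm1, mkm1) := traj xi k' in
      let: (mk, xk1) := sfom_step k' xk xkm1 mkm1 (xi k') in
      (xk1, xk, mk)
  end.

Definition xseq (xi : nat -> Xi) (k : nat) : V := (traj xi k).1.1.
Definition mseq (xi : nat -> Xi) (k : nat) : V := (traj xi k.+1).2.

End Algo.

Definition path_upd (T : Type) (xi : nat -> T) (k : nat) (s : T) : nat -> T :=
  fun j => if j == k then s else xi j.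

(* Main.v *)
(** Let v be the unit vector -m^k/|m^k|, so that x^{k+1} = x^k + eta v and
    z^{k+1,t} = x^k + (eta/gamma_t) v. All gradients then lie on one line, and
    Taylor expansion of s |-> D_u f(x^k + s v) to order p-1 shows that the
    moment conditions sum_t theta_t / gamma_t^j = 1 cancel every term of the bias
      D = (1 - Th) grad f(x^k) + sum_t theta_t grad f(z^{k+1,t}) - grad f(x^{k+1})
    except the remainders. The new momentum error is (1 - Th) e + D plus the
    centred noise, where e = m^k - grad f(x^k); convexity of the squared norm
    gives |(1 - Th) e + D|^2 <= (1 - Th) |e|^2 + |D|^2 / Th. The term
    2 eta |e| of the descent inequality is absorbed, by Young's inequality, in the
    slack Th p_k |e|^2 / (p+1) left by the condition on (p_k). *)
Require Import Defs.
From HB Require Import structures.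
From mathcomp Require Import all_boot all_order all_algebra.
From mathcomp Require Import all_classical all_reals all_analysis.
From mathcomp Require Import measurable_realfun ring lra.
Import Order.TTheory GRing.Theory Num.Theory.
Import numFieldNormedType.Exports.
Local Open Scope ring_scope.

(** * Quadratic inequalities for finite sums *)

Section FiniteSums.
Set Implicit Arguments. Unset Strict Implicit.
Variables (R : realType) (n : nat).
Implicit Types a b : 'I_n -> R.

(** Multiplied by [B], the gap [A * B - C ^+ 2] becomes the sum of squares of [B * a i - C * b i].
    If [B] vanishes, so does every [b i]. *)
Lemma cauchy_schwarz_sum a b :
  (\sum_i a i * b i) ^+ 2 <= (\sum_i a i ^+ 2) * \sum_i b i ^+ 2.
Proof.
set A := \sum_i a i ^+ 2; set B := \sum_i b i ^+ 2; set C := \sum_i a i * b i.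
have B_ge0 : 0 <= B by apply: sumr_ge0 => i _; exact: sqr_ge0.
have : 0 <= B * (A * B - C ^+ 2).
  have -> : B * (A * B - C ^+ 2) = \sum_i (B * a i - C * b i) ^+ 2.
    rewrite (eq_bigr (fun i => B ^+ 2 * a i ^+ 2 - (2 * B * C) * (a i * b i)
      + C ^+ 2 * b i ^+ 2)); last by move=> i _; ring.
    rewrite big_split sumrB /= -!mulr_sumr -/A -/B -/C; ring.
  by apply: sumr_ge0 => i _; exact: sqr_ge0.
move: B_ge0; rewrite le_eqVlt => /predU1P[B0 _|B_gt0]; last first.
  by rewrite pmulr_rge0 // subr_ge0.
rewrite -B0 mulr0 /C big1 ?expr0n // => i _.
move/esym/eqP: B0; rewrite psumr_eq0; last by move=> j _; exact: sqr_ge0.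
by move=> /allP/(_ i (mem_index_enum _)); rewrite /= sqrf_eq0 => /eqP ->; rewrite mulr0.
Qed.

Lemma sqr_sum_le a : (\sum_i a i) ^+ 2 <= n%:R * \sum_i a i ^+ 2.
Proof.
have := cauchy_schwarz_sum (fun=> 1) a.
under eq_bigr do rewrite mul1r.
by under [X in X * _]eq_bigr do rewrite expr1n; rewrite sumr_const card_ord.
Qed.

(** Cauchy-Schwarz for the [n.+1] numbers 1 and [a i]. With [n = p.-1] it is the source of the
    factor [p] in the bias term of the theorem. *)
Lemma sqr_add1_sum_le a :
  (1 + \sum_i a i) ^+ 2 <= n.+1%:R * (1 + \sum_i a i ^+ 2).
Proof.
have : 2 * \sum_i a i <= n%:R + \sum_i a i ^+ 2.
  have -> : n%:R = \sum_(i < n) (1 : R) by rewrite sumr_const card_ord.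
  rewrite mulr_sumr -big_split; apply: ler_sum => i _ /=.
  by have := sqr_ge0 (a i - 1); nra.
have := sqr_sum_le a; rewrite -natr1; nra.
Qed.

End FiniteSums.

(** * Inner product and Euclidean norm on row vectors *)

Section EuclideanNorm.
Set Implicit Arguments. Unset Strict Implicit.
Variables (R : realType) (n : nat).
Implicit Types u v w : 'rV[R]_n.

Definition dotv u v : R := \sum_i u 0 i * v 0 i.

Lemma dotvBl u v w : dotv (u - v) w = dotv u w - dotv v w.
Proof. by rewrite -sumrB; apply: eq_bigr => i _; rewrite !mxE mulrBl. Qed.

Lemma dotvDl u v w : dotv (u + v) w = dotv u w + dotv v w.
Proof. by rewrite -big_split; apply: eq_bigr => i _; rewrite !mxE mulrDl. Qed.

Lemma dotvZl c u v : dotv (c *: u) v = c * dotv u v.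
Proof. by rewrite mulr_sumr; apply: eq_bigr => i _; rewrite !mxE mulrA. Qed.

Lemma dotvZr c u v : dotv u (c *: v) = c * dotv u v.
Proof. by rewrite mulr_sumr; apply: eq_bigr => i _; rewrite !mxE mulrCA. Qed.

Lemma dotv_suml I (r : seq I) (F : I -> 'rV[R]_n) v :
  dotv (\sum_(i <- r) F i) v = \sum_(i <- r) dotv (F i) v.
Proof.
rewrite /dotv exchange_big /=; apply: eq_bigr => i _.
by rewrite summxE mulr_suml.
Qed.

Lemma enorm_ge0 v : 0 <= enorm v. Proof. exact: sqrtr_ge0. Qed.

Lemma enorm_sqr v : enorm v ^+ 2 = \sum_i v 0 i ^+ 2.
Proof. by rewrite sqr_sqrtr // sumr_ge0 // => i _; exact: sqr_ge0. Qed.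

Lemma dotvv v : dotv v v = enorm v ^+ 2.
Proof. by rewrite enorm_sqr; apply: eq_bigr => i _; rewrite expr2. Qed.

Lemma enormZ c v : enorm (c *: v) = `|c| * enorm v.
Proof.
rewrite /enorm -sqrtr_sqr -sqrtrM ?sqr_ge0 // mulr_sumr.
by congr Num.sqrt; apply: eq_bigr => i _; rewrite mxE exprMn.
Qed.

Lemma enormB_sym u v : enorm (u - v) = enorm (v - u).
Proof. by rewrite -opprB -scaleN1r enormZ normrN1 mul1r. Qed.

Lemma enorm_eq0 v : (enorm v == 0) = (v == 0).
Proof.
apply/idP/eqP => [|->]; last first.
  by rewrite -(scale0r (0 : 'rV[R]_n)) enormZ normr0 mul0r.
rewrite -sqrf_eq0 enorm_sqr psumr_eq0; last by move=> i _; exact: sqr_ge0.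
move=> /allP v0; apply/rowP => i; rewrite mxE; apply/eqP.
by rewrite -sqrf_eq0; exact: v0 (mem_index_enum i).
Qed.

Lemma normr_dotv_le u v : `|dotv u v| <= enorm u * enorm v.
Proof.
rewrite -(@ler_pXn2r _ 2) ?nnegrE ?normr_ge0 ?mulr_ge0 ?enorm_ge0 //.
by rewrite exprMn !enorm_sqr real_normK ?num_real // cauchy_schwarz_sum.
Qed.

Lemma dotv_le u v : dotv u v <= enorm u * enorm v.
Proof. exact: le_trans (ler_norm _) (normr_dotv_le _ _). Qed.

Lemma enorm_sqrD u v : enorm (u + v) ^+ 2 = enorm u ^+ 2 + 2 * dotv u v + enorm v ^+ 2.
Proof.
rewrite !enorm_sqr mulr_sumr -!big_split; apply: eq_bigr => i _ /=.
by rewrite mxE; ring.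
Qed.

Lemma enormD_le u v : enorm (u + v) <= enorm u + enorm v.
Proof.
rewrite -(@ler_pXn2r _ 2) ?nnegrE ?addr_ge0 ?enorm_ge0 // enorm_sqrD.
have := dotv_le u v; nra.
Qed.

Lemma enorm_normalize v : v != 0 -> enorm ((enorm v)^-1 *: v) = 1.
Proof.
move=> v0; rewrite enormZ ger0_norm ?invr_ge0 ?enorm_ge0 //.
by rewrite mulVf // enorm_eq0.
Qed.

(** Duality: testing against [v] divided by its norm suffices, and [v = 0] is treated apart because
    it cannot be normalized. Vector estimates thus reduce to scalar ones. *)
Lemma enorm_le_dotv v C : 0 <= C ->
  (forall u, enorm u = 1 -> dotv v u <= C) -> enorm v <= C.
Proof.
move=> C0 vC; have [->|v0] := eqVneq v 0.
  by move: (enorm_eq0 (0 : 'rV[R]_n)); rewrite eqxx => /eqP ->.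
have := vC _ (enorm_normalize v0).
by rewrite dotvZr dotvv expr2 mulKf // enorm_eq0.
Qed.

Lemma enorm_sqr_sum_le q (w : 'I_q -> 'rV[R]_n) :
  enorm (\sum_t w t) ^+ 2 <= q%:R * \sum_t enorm (w t) ^+ 2.
Proof.
rewrite enorm_sqr (eq_bigr (fun t => \sum_i w t 0 i ^+ 2)); last first.
  by move=> t _; rewrite enorm_sqr.
rewrite exchange_big mulr_sumr; apply: ler_sum => i _ /=.
by rewrite summxE sqr_sum_le.
Qed.

(** Convexity of the squared norm at [u] and [v / T] with weights [1 - T] and [T]. In each
    coordinate the gap is an explicit multiple of a square. *)
Lemma enorm_sqr_convex T u v : 0 < T < 1 ->
  enorm ((1 - T) *: u + v) ^+ 2 <= (1 - T) * enorm u ^+ 2 + enorm v ^+ 2 / T.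
Proof.
move=> /andP[T0 T1]; rewrite !enorm_sqr mulr_sumr mulr_suml -big_split.
apply: ler_sum => i _ /=; rewrite !mxE -subr_ge0.
have -> : (1 - T) * u 0 i ^+ 2 + v 0 i ^+ 2 / T - ((1 - T) * u 0 i + v 0 i) ^+ 2
  = (1 - T) / T * (T * u 0 i - v 0 i) ^+ 2 by field; rewrite gt_eqF.
by rewrite mulr_ge0 ?sqr_ge0 ?divr_ge0 ?subr_ge0 // ltW.
Qed.

End EuclideanNorm.

(** * Directional derivatives and restriction to a line *)

Section LineDerivatives.
Set Implicit Arguments. Unset Strict Implicit.
Variables (R : realType) (n : nat).
Implicit Types (F f : 'rV[R]_n -> R) (u v x : 'rV[R]_n).

Lemma dotv_grad f x u : differentiable f x -> dotv (grad f x) u = 'D_u f x.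
Proof.
move=> df; rewrite deriveE // {2}(row_sum_delta u) linear_sum.
by apply: eq_bigr => i _; rewrite mxE deriveE // linearZ /= mulrC.
Qed.

(** The difference quotient of the restriction at [s] is the same function of [h] as that of [F] at
    [x + s *: v] along [v], so both limits agree. *)
Lemma is_derive_line F x v (s : R) : differentiable F (x + s *: v) ->
  is_derive s (1 : R) (fun s => F (x + s *: v)) ('D_v F (x + s *: v)).
Proof.
move=> dF; have dFv : derivable F (x + s *: v) v by exact: diff_derivable.
have E : (fun h => h^-1 *: (((fun s => F (x + s *: v)) \o shift s) (h *: (1 : R))
                            - F (x + s *: v)))
   = (fun h => h^-1 *: ((F \o shift (x + s *: v)) (h *: v) - F (x + s *: v))).
  apply/funext => h /=; congr (_ *: (F _ - _)).
  by rewrite scalerDl -[h *: 1]/(h * 1) mulr1 addrCA.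
by split; rewrite /derivable /derive E.
Qed.

End LineDerivatives.

(** * One-variable Taylor estimates and cancellation by extrapolation *)

Section Taylor.
Set Implicit Arguments. Unset Strict Implicit.
Variable R : realType.

Lemma ge0_derive_ge0 (k dk : R -> R) s :
  (forall t, is_derive t (1 : R) k (dk t)) ->
  (forall t, 0 <= t -> 0 <= dk t) -> k 0 = 0 -> 0 <= s -> 0 <= k s.
Proof.
move=> kD dk0 k0 s0.
have kc : {within `[0, s]%classic, continuous k}%classic.
  by apply: derivable_within_continuous => t _; exact: ex_derive.
have [c cs] := MVT_segment s0 (fun t _ => kD t) kc.
rewrite k0 !subr0 => ->; apply: mulr_ge0 => //; apply: dk0.
by move: cs; rewrite in_itv => /andP[].
Qed.

(** Induction on [N]: the estimate for the shifted family bounds the derivative of the remainder,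
    and the mean value theorem passes from the derivative to the function, with no integration. *)
Lemma taylor_lipschitz N (g : nat -> R -> R) (L : R) :
  (forall j (s : R), (j < N)%N -> is_derive s (1 : R) (g j) (g j.+1 s)) ->
  (forall s : R, 0 <= s -> `|g N s - g N 0| <= L * s) ->
  forall s : R, 0 <= s ->
  `|g 0%N s - \sum_(j < N.+1) g j 0 / j`!%:R * s ^+ j|
    <= L / N.+1`!%:R * s ^+ N.+1.
Proof.
elim: N g => [|N IH] g gD gL s s0.
  by rewrite big_ord1 fact0 !divr1 expr0 mulr1 expr1 gL.
pose p := \poly_(j < N.+2) (g j 0 / j`!%:R).
pose M := L / N.+2`!%:R.
have natr_neq0 m : (m.+1%:R : R) != 0 by rewrite pnatr_eq0.
have factS m : (m.+1`!%:R : R) = m.+1%:R * m`!%:R by rewrite factS natrM.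
have dpE t : p^`().[t] = \sum_(j < N.+1) g j.+1 0 / j`!%:R * t ^+ j.
  rewrite -(horner_poly N.+1 (fun j => g j.+1 0 / j`!%:R)); congr (_.[t]).
  apply/polyP => j; rewrite coef_deriv !coef_poly ltnS.
  case: ifP => _; last by rewrite mul0rn.
  by rewrite -[LHS]mulr_natr factS invfM [_^-1 * _^-1]mulrC mulrA divfK.
have hM t : 0 <= t -> `|g 1%N t - p^`().[t]| <= M * N.+2%:R * t ^+ N.+1.
  move=> t0; rewrite dpE.
  have -> : M * N.+2%:R = L / N.+1`!%:R.
    by rewrite /M factS invfM [_^-1 * _^-1]mulrC mulrA divfK.
  by apply: (IH (fun j => g j.+1)) => // j r jN; exact: gD.
have p0 : p.[0] = g 0%N 0.
  by rewrite horner_coef0 coef_poly /= fact0 divr1.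
rewrite -(horner_poly N.+2 (fun j => g j 0 / j`!%:R)) -/p -/M.
(* The cases [c = 1] and [c = -1] give the two halves of the absolute value. The expression vanishes
   at 0 and has nonnegative derivative by [hM]; its polynomial part is gathered in [r] so that it
   can be differentiated formally. *)
have sgn (c : R) : `|c| = 1 -> 0 <= M * s ^+ N.+2 - c * (g 0%N s - p.[s]).
  move=> c1; pose r := M *: 'X^(N.+2) + c *: p.
  have rE t : r.[t] - c * g 0%N t = M * t ^+ N.+2 - c * (g 0%N t - p.[t]).
    by rewrite /r !hornerE; ring.
  rewrite -rE; apply: (@ge0_derive_ge0 (fun t => r.[t] - c * g 0%N t)
                                       (fun t => r^`().[t] - c * g 1%N t)) => //.
  - by move=> t; exact: is_deriveB (is_derive_poly r t) (is_deriveZ c (gD 0%N t isT)).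
  - move=> t t0.
    have -> : r^`().[t] - c * g 1%N t
        = M * N.+2%:R * t ^+ N.+1 - c * (g 1%N t - p^`().[t]).
      rewrite /r derivD !derivZ derivXn hornerD !hornerZ hornerMn hornerXn
        -[X in M * X + _]mulr_natr /=; ring.
    rewrite subr_ge0 (le_trans _ (hM _ t0)) //.
    by rewrite (le_trans (ler_norm _)) // normrM c1 mul1r.
  - by rewrite rE p0 subrr expr0n !mulr0 subr0.
rewrite ler_norml; apply/andP; split.
  by have := sgn (-1); rewrite normrN1 => /(_ erefl); lra.
by have := sgn 1; rewrite normr1 => /(_ erefl); lra.
Qed.

(** On a monomial of degree 1 to [q] the moment conditions make the weighted values at [eta / gam t]
    sum to the value at [eta]; the weight [1 - \sum_t theta t] settles the constant term. Only the
    remainders at [eta / gam t] and at [eta] survive. *)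
Lemma extrapolation_bound q (theta gam : 'I_q -> R) (g : R -> R)
    (a : nat -> R) (eta C : R) :
  0 < eta -> (forall t, 0 < gam t) ->
  (forall j, (1 <= j <= q)%N -> \sum_t theta t / gam t ^+ j = 1) ->
  (forall s : R, 0 <= s -> `|g s - \sum_(j < q.+1) a j * s ^+ j| <= C * s ^+ q.+1) ->
  `|(1 - \sum_t theta t) * g 0 + \sum_t theta t * g (eta / gam t) - g eta|
    <= C * eta ^+ q.+1 * (1 + \sum_t `|theta t| / gam t ^+ q.+1).
Proof.
move=> eta0 gam0 moment gC.
pose r s := g s - \sum_(j < q.+1) a j * s ^+ j.
(* At [s = 0] the error bound is zero, which forces equality. *)
have g0 : g 0 = a 0%N.
  have := gC _ (lexx 0); rewrite expr0n mulr0 normr_le0 subr_eq0 => /eqP ->.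
  by rewrite big_ord_recl expr0 mulr1 big1 ?addr0 // => i _; rewrite expr0n mulr0.
have -> : (1 - \sum_t theta t) * g 0 + \sum_t theta t * g (eta / gam t) - g eta
  = \sum_t theta t * r (eta / gam t) - r eta.
  rewrite /r; under [X in _ = X - _]eq_bigr do rewrite mulrBr.
  rewrite sumrB.
  have -> : \sum_t theta t * (\sum_(j < q.+1) a j * (eta / gam t) ^+ j)
    = (\sum_t theta t) * a 0%N + \sum_(j < q) a j.+1 * eta ^+ j.+1.
    under eq_bigr do rewrite mulr_sumr.
    rewrite exchange_big big_ord_recl /=; congr (_ + _).
      by rewrite mulr_suml; apply: eq_bigr => t _; rewrite expr0 mulr1.
    (* The factor 1 is replaced by the moment sum of order [j.+1]. *)
    apply: eq_bigr => j _; rewrite -[RHS]mulr1 -(moment j.+1) ?ltn_ord //.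
    rewrite mulr_sumr; apply: eq_bigr => t _.
    by rewrite /bump /= add1n expr_div_n; ring.
  by rewrite big_ord_recl expr0 g0 /bump /=; ring.
have r_eta : `|r eta| <= C * eta ^+ q.+1 by rewrite gC // ltW.
have r_sum : `|\sum_t theta t * r (eta / gam t)|
    <= C * eta ^+ q.+1 * \sum_t `|theta t| / gam t ^+ q.+1.
  rewrite (le_trans (ler_norm_sum _ _ _)) // mulr_sumr; apply: ler_sum => t _.
  have s0 : 0 <= eta / gam t by rewrite divr_ge0 // ltW.
  rewrite normrM (le_trans (ler_wpM2l (normr_ge0 _) (gC _ s0))) //.
  by rewrite expr_div_n le_eqVlt; apply/orP; left; apply/eqP; ring.
by rewrite mulrDr mulr1 (le_trans (ler_normB _ _)) // addrC lerD.
Qed.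

End Taylor.

(** * Descent inequality and bias of the extrapolated gradients *)

Section SmoothFunction.
Set Implicit Arguments. Unset Strict Implicit.
Variables (R : realType) (n : nat) (f : 'rV[R]_n -> R).
Implicit Types u v x m : 'rV[R]_n.

(** The case [N = 1] of [taylor_lipschitz] along the line through [x] with direction [v]. *)
Lemma descent_lemma (L1 : R) x v (eta : R) :
  (forall y, differentiable f y) ->
  (forall y z, enorm (grad f z - grad f y) <= L1 * enorm (z - y)) ->
  enorm v = 1 -> 0 <= eta ->
  f (x + eta *: v) <= f x + eta * dotv (grad f x) v + L1 / 2 * eta ^+ 2.
Proof.
move=> df gradL v1 eta0.
pose g j s := if j is 0%N then f (x + s *: v) else 'D_v f (x + s *: v).
have gD j (s : R) : (j < 1)%N -> is_derive s (1 : R) (g j) (g j.+1 s).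
  by case: j => // _; exact: is_derive_line.
have gL (s : R) : 0 <= s -> `|g 1%N s - g 1%N 0| <= L1 * s.
  move=> s0; rewrite /g -!dotv_grad // -dotvBl (le_trans (normr_dotv_le _ _)) //.
  rewrite v1 mulr1 (le_trans (gradL _ _)) //.
  by rewrite scale0r addr0 addrAC subrr add0r enormZ v1 mulr1 ger0_norm.
have := taylor_lipschitz gD gL eta0; rewrite ler_norml => /andP[_].
rewrite !big_ord_recl big_ord0 /= /bump /= scale0r addr0 expr1 expr0.
rewrite !divr1 mulr1 addr0 dotv_grad // (_ : 2`! = 2%N) //; lra.
Qed.

Lemma normalized_step_descent (L1 : R) x m (eta : R) :
  (forall y, differentiable f y) ->
  (forall y z, enorm (grad f z - grad f y) <= L1 * enorm (z - y)) ->
  m != 0 -> 0 <= eta ->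
  f (x + eta *: (- (enorm m)^-1 *: m)) <= f x - eta * enorm (grad f x)
    + 2 * eta * enorm (m - grad f x) + L1 / 2 * eta ^+ 2.
Proof.
move=> df gradL m0 eta0; set g := grad f x; set v := _ *: m.
have nm0 : 0 < enorm m by rewrite lt_neqAle enorm_ge0 eq_sym enorm_eq0 m0.
have v1 : enorm v = 1.
  by rewrite enormZ normrN ger0_norm ?invr_ge0 ?mulVf ?gt_eqF // ltW.
apply: le_trans (descent_lemma x df gradL v1 eta0) _; rewrite -/g lerD2r.
(* Since [dotv m v = - enorm m], replacing [m] by [g] in the inner product costs one
   [enorm (m - g)], and replacing [enorm m] by [enorm g] costs another. *)
suff : dotv g v <= - enorm g + 2 * enorm (m - g) by nra.
have -> : dotv g v = - enorm m - dotv (m - g) v.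
  rewrite dotvBl opprB addrCA -[LHS]addr0; congr (_ + _).
  by rewrite dotvZr dotvv; field; rewrite gt_eqF.
have := normr_dotv_le (m - g) v; rewrite v1 mulr1 ler_norml => /andP[+ _].
have := enormD_le m (g - m); rewrite addrC subrK (enormB_sym g); lra.
Qed.

Variables (p : nat) (Lp : R).
Hypothesis p2 : (2 <= p)%N.
Hypothesis fCp : Cp p f.
Hypothesis fLp : forall x y (hs : seq 'rV[R]_n), seq.size hs = p ->
  (forall h, h \in hs -> enorm h <= 1) ->
  iter_dirder hs f y - iter_dirder hs f x <= Lp * enorm (y - x).

Lemma Cp_differentiable x : differentiable f x.
Proof. by have := fCp.1 [::] => /=; apply; rewrite (leq_trans _ p2). Qed.

(* Only derivatives in the directions v, ..., v, u occur, with u innermost, so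
   the symmetry of D^p f is not needed. *)
Lemma dirder_taylor x u v (s : R) : enorm u = 1 -> enorm v = 1 -> 0 <= s ->
  `|'D_u f (x + s *: v)
    - \sum_(j < p) iter_dirder (nseq j v ++ [:: u]) f x / j`!%:R * s ^+ j|
  <= Lp / p`!%:R * s ^+ p.
Proof.
move=> u1 v1 s0; have pE : p.-1.+1 = p by rewrite prednK // (leq_trans _ p2).
(* [g j] is a derivative of order [j.+1], because [u] already counts for one. Hence the Taylor
   estimate is used with [N = p.-1], where the Lipschitz bound on the [p]th derivative applies. *)
pose g j s := iter_dirder (nseq j v ++ [:: u]) f (x + s *: v).
have gD j (r : R) : (j < p.-1)%N -> is_derive r (1 : R) (g j) (g j.+1 r).
  move=> jp; apply: is_derive_line; apply: fCp.1.
  by rewrite size_cat size_nseq addn1 -pE ltnS.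
have gL (r : R) : 0 <= r -> `|g p.-1 r - g p.-1 0| <= Lp * r.
  move=> r0.
  have szp : seq.size (nseq p.-1 v ++ [:: u]) = p by rewrite size_cat size_nseq addn1.
  have h1 h : h \in nseq p.-1 v ++ [:: u] -> enorm h <= 1.
    by rewrite mem_cat mem_nseq inE => /orP[/andP[_ /eqP ->]|/eqP ->]; rewrite ?v1 ?u1.
  have dr : enorm ((x + r *: v) - (x + 0 *: v)) = r.
    by rewrite scale0r addr0 addrAC subrr add0r enormZ v1 mulr1 ger0_norm.
  (* [fLp] is one-sided; using it in both orders of the points bounds the absolute value. *)
  have := fLp (x + r *: v) (x + 0 *: v) szp h1; rewrite enormB_sym dr => H1.
  have := fLp (x + 0 *: v) (x + r *: v) szp h1; rewrite dr => H2.
  by rewrite ler_norml /g; apply/andP; split; lra.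
have := taylor_lipschitz gD gL s0; rewrite pE.
by rewrite {1}/g /= /g scale0r addr0.
Qed.

(** Paired with a unit vector [u], the bias is the extrapolation error of the scalar function taking
    [s] to ['D_u f (x + s *: v)]. The resulting bound does not depend on [u], so it passes to the
    norm. *)
Lemma extrapolated_gradient_bias q (theta gam : 'I_q -> R) x v (eta : R) :
  q.+1 = p -> 0 <= Lp -> enorm v = 1 -> 0 < eta -> (forall t, 0 < gam t) ->
  (forall j, (1 <= j <= q)%N -> \sum_t theta t / gam t ^+ j = 1) ->
  enorm ((1 - \sum_t theta t) *: grad f x
         + \sum_t theta t *: grad f (x + (eta / gam t) *: v)
         - grad f (x + eta *: v))
    <= Lp / p`!%:R * eta ^+ p * (1 + \sum_t `|theta t| / gam t ^+ p).
Proof.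
move=> qp Lp0 v1 eta0 gam0 moment.
apply: enorm_le_dotv => [|u u1].
  apply: mulr_ge0; first by rewrite mulr_ge0 ?divr_ge0 ?exprn_ge0 ?ler0n // ltW.
  by rewrite addr_ge0 // sumr_ge0 // => t _; rewrite divr_ge0 // exprn_ge0 // ltW.
rewrite dotvBl dotvDl dotvZl dotv_suml.
have gradE y : dotv (grad f y) u = 'D_u f y.
  by rewrite dotv_grad //; exact: Cp_differentiable.
under [X in _ + X - _]eq_bigr do rewrite dotvZl gradE.
rewrite !gradE.
have := @extrapolation_bound R q theta gam (fun s => 'D_u f (x + s *: v))
  (fun j => iter_dirder (nseq j v ++ [:: u]) f x / j`!%:R) eta (Lp / p`!%:R)
  eta0 gam0 moment.
rewrite qp scale0r addr0 => H; apply: le_trans (ler_norm _) _; apply: H => s s0.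
exact: dirder_taylor.
Qed.

End SmoothFunction.

(** * Integration of the noise over one sample *)

Section SecondMoment.
Set Implicit Arguments. Unset Strict Implicit.
Variables (R : realType) (d : measure_display) (Xi : measurableType d).
Variable P : probability Xi R.
Local Notation intble h := (P.-integrable setT (EFin \o (h : Xi -> R))).

(** Both claims share one induction, since additivity of the integral needs the partial sums to be
    integrable. *)
Lemma Rintegral_sum I (r : seq I) (h : I -> Xi -> R) :
  (forall i, intble (h i)) ->
  intble (fun s => \sum_(i <- r) h i s) /\
  Rintegral P setT (fun s => \sum_(i <- r) h i s)
    = \sum_(i <- r) Rintegral P setT (h i).
Proof.
move=> hi; elim: r => [|i r [IHi IHe]].
  rewrite big_nil; under [in X in X /\ _]eq_fun do rewrite big_nil.
  under eq_Rintegral do rewrite big_nil.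
  by split; [exact: integrable0 | rewrite Rintegral_cst // mul0r].
have E : (fun s => \sum_(j <- i :: r) h j s)
    = (fun s => h i s + \sum_(j <- r) h j s).
  by apply/funext => s; rewrite big_cons.
rewrite E big_cons -IHe RintegralD //; split => //.
exact: (integrableD _ (hi i) IHi).
Qed.

Lemma intbleZ c h : intble h -> intble (fun s => c * h s).
Proof. by move=> hi; exact: (integrableZl _ c hi). Qed.

Lemma intbleD g h : intble g -> intble h -> intble (fun s => g s + h s).
Proof. by move=> gi hi; exact: (integrableD _ gi hi). Qed.

Lemma intble_cst c : intble (fun=> c).
Proof. exact: finite_measure_integrable_cst. Qed.

Lemma integral_EFin h : intble h ->
  (\int[P]_(s in setT) (h s)%:E = (Rintegral P setT h)%:E)%E.
Proof. by move=> hi; rewrite /Rintegral fineK //; exact: integrable_fin_num. Qed.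

Lemma Rintegral_probability_cst c : Rintegral P setT (fun=> c) = c.
Proof.
rewrite Rintegral_cst //; transitivity (c * fine (P setT)) => //.
by rewrite probability_setT mulr1.
Qed.

Lemma measurable_enorm_sqr n (v : Xi -> 'rV[R]_n) :
  (forall i, measurable_fun setT (fun s => v s 0 i)) ->
  measurable_fun setT (fun s => enorm (v s) ^+ 2).
Proof.
move=> mv; have -> : (fun s => enorm (v s) ^+ 2)
    = (fun s => \sum_i v s 0 i * v s 0 i).
  by apply/funext => s; rewrite -dotvv.
by apply: measurable_sum => i; exact: measurable_funM.
Qed.

Lemma integrable_enorm_sqr n (v : Xi -> 'rV[R]_n) (C : R) :
  (forall i, measurable_fun setT (fun s => v s 0 i)) ->
  (\int[P]_(s in setT) (enorm (v s) ^+ 2)%:E <= C%:E)%E ->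
  intble (fun s => enorm (v s) ^+ 2).
Proof.
move=> mv vC; apply/integrableP; split.
  by apply/measurable_EFinP; exact: measurable_enorm_sqr.
rewrite (le_lt_trans _ (ltry C)) // (le_trans _ vC) //.
by under eq_integral do rewrite /= ger0_norm ?sqr_ge0 //.
Qed.

(** After expanding the square, the cross term has mean zero. All [w t] share the same sample, so
    they need not be uncorrelated, and the noise square is bounded by Cauchy-Schwarz at the price of
    the factor [q]. The constants [c] and [b] let it apply to the whole potential. *)
Lemma noise_second_moment n q (w : 'I_q -> Xi -> 'rV[R]_n) (theta : 'I_q -> R)
    (a : 'rV[R]_n) (sigma b c : R) :
  (forall t i, intble (fun s => w t s 0 i)) ->
  (forall t i, (\int[P]_(s in setT) (w t s 0 i)%:E = 0)%E) ->
  (forall t, (\int[P]_(s in setT) (enorm (w t s) ^+ 2)%:E <= (sigma ^+ 2)%:E)%E) ->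
  0 <= b ->
  (\int[P]_(s in setT) (c + b * enorm (a + \sum_t theta t *: w t s) ^+ 2)%:E
    <= (c + b * (enorm a ^+ 2 + q%:R * sigma ^+ 2 * \sum_t theta t ^+ 2))%:E)%E.
Proof.
move=> wi w0 wv b0.
have mw t i : measurable_fun setT (fun s => w t s 0 i).
  by apply/measurable_EFinP; exact: measurable_int (wi t i).
have w2i t := integrable_enorm_sqr (mw t) (wv t).
pose cross s := \sum_t 2 * theta t * dotv a (w t s).
pose square s := \sum_t q%:R * theta t ^+ 2 * enorm (w t s) ^+ 2.
have doti t := Rintegral_sum (index_enum 'I_n)
  (fun i => intbleZ (a 0 i) (wi t i)).
have crossi := Rintegral_sum (index_enum 'I_q)
  (fun t => intbleZ (2 * theta t) (doti t).1).
have squarei := Rintegral_sum (index_enum 'I_q)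
  (fun t => intbleZ (q%:R * theta t ^+ 2) (w2i t)).
(* A pointwise majorant of the integrand whose integral can be computed term by term. *)
pose B s := c + b * (enorm a ^+ 2 + (cross s + square s)).
have csi := intbleD crossi.1 squarei.1.
have ai := intbleD (intble_cst (enorm a ^+ 2)) csi.
have Bi : intble B := intbleD (intble_cst c) (intbleZ b ai).
have cross0 : Rintegral P setT cross = 0.
  rewrite crossi.2 big1 // => t _; rewrite RintegralZl //; last exact: (doti t).1.
  rewrite (doti t).2 big1 ?mulr0 // => i _; rewrite RintegralZl //.
  by rewrite /Rintegral w0 mulr0.
have square_le : Rintegral P setT square <= q%:R * sigma ^+ 2 * \sum_t theta t ^+ 2.
  rewrite squarei.2 mulr_sumr; apply: ler_sum => t _; rewrite RintegralZl //.
  rewrite [leRHS]mulrAC; apply: ler_wpM2l; first by rewrite mulr_ge0 ?ler0n ?sqr_ge0.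
  by have := wv t; rewrite (integral_EFin (w2i t)) lee_fin.
have FB s : c + b * enorm (a + \sum_t theta t *: w t s) ^+ 2 <= B s.
  rewrite /B lerD2l ler_wpM2l // enorm_sqrD -addrA lerD2l lerD //.
    rewrite /cross /dotv mulr_sumr; under [leRHS]eq_bigr do rewrite mulr_sumr.
    rewrite exchange_big /=; apply: ler_sum => i _.
    rewrite summxE !mulr_sumr; apply: ler_sum => t _.
    by rewrite mxE le_eqVlt; apply/orP; left; apply/eqP; ring.
  apply: le_trans (enorm_sqr_sum_le _) _; rewrite mulr_sumr; apply: ler_sum => t _.
  by rewrite enormZ exprMn real_normK ?num_real // mulrA.
have F_ge s : c <= c + b * enorm (a + \sum_t theta t *: w t s) ^+ 2.
  by rewrite lerDl mulr_ge0 ?sqr_ge0.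
(* The integrand lies between [c] and [B s], so the sum of their absolute values dominates it. *)
have Fi : intble (fun s => c + b * enorm (a + \sum_t theta t *: w t s) ^+ 2).
  apply: (@le_integrable _ _ _ _ _ measurableT _ (EFin \o (fun s => `|B s| + `|c|))).
  - apply/measurable_EFinP; apply: measurable_funD => //; apply: measurable_funM => //.
    apply: measurable_enorm_sqr => i.
    have -> : (fun s => (a + \sum_t theta t *: w t s) 0 i)
        = (fun s => a 0 i + \sum_t theta t * w t s 0 i).
      by apply/funext => s; rewrite mxE summxE; under eq_bigr do rewrite mxE.
    apply: measurable_funD => //; apply: measurable_sum => t.
    exact: measurable_funM.
  - move=> s _ /=; rewrite lee_fin [leRHS]ger0_norm ?addr_ge0 //.
    have := FB s; have := F_ge s; have := ler_norm (B s); have := normr_ge0 (B s).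
    have := lerNnormlW (lexx `|c|); have := normr_ge0 c.
    by rewrite ler_norml => *; apply/andP; split; lra.
  - exact: intbleD (integrable_norm Bi) (intble_cst `|c|).
apply: (@le_trans _ _ (Rintegral P setT B)%:E).
  by rewrite integral_EFin // lee_fin le_Rintegral.
rewrite lee_fin /B RintegralD //; [|exact: intble_cst|exact: intbleZ].
rewrite Rintegral_probability_cst lerD2l.
rewrite RintegralZl // ler_wpM2l // RintegralD //; last exact: intble_cst.
rewrite Rintegral_probability_cst lerD2l.
by rewrite RintegralD //; [rewrite cross0 add0r|exact: crossi.1|exact: squarei.1].
Qed.

End SecondMoment.

(** * Dependence of the iterates on the samples, and one-step recursions *)

Section Trajectory.
Set Implicit Arguments. Unset Strict Implicit.
Variables (R : realType) (n : nat) (d : measure_display) (Xi : measurableType d).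
Variables (q : nat) (G : 'rV[R]_n -> Xi -> 'rV[R]_n) (x0 : 'rV[R]_n)
  (eta : nat -> R) (gam theta : nat -> 'I_q -> R).
Implicit Type xi : nat -> Xi.
Local Notation traj := (traj G x0 eta gam theta).
Local Notation xseq := (xseq G x0 eta gam theta).
Local Notation mseq := (mseq G x0 eta gam theta).

(** The state at [k] reads only the samples of index below [k]. This justifies rendering the
    conditional expectation as an integral over one replaced sample. *)
Lemma traj_path_upd xi j s k : (k <= j)%N ->
  traj (path_upd xi j s) k = traj xi k.
Proof.
elim: k => //= k IH kj; rewrite IH ?(ltnW kj) //.
by rewrite /path_upd (ltn_eqF kj).
Qed.

Lemma xseq_path_upd xi j s k : (k <= j)%N ->
  xseq (path_upd xi j s) k = xseq xi k.
Proof. by move=> kj; rewrite /Defs.xseq traj_path_upd. Qed.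

Lemma mseq_path_upd xi j s k : (k < j)%N ->
  mseq (path_upd xi j s) k = mseq xi k.
Proof. by move=> kj; rewrite /Defs.mseq traj_path_upd. Qed.

Lemma trajS xi k : traj xi k.+1 = (xseq xi k.+1, xseq xi k, mseq xi k).
Proof.
by rewrite /Defs.mseq /Defs.xseq /=; case: (traj xi k) => [[x y] m].
Qed.

Lemma xseqS xi k : xseq xi k.+1
  = xseq xi k + eta k *: (- (enorm (mseq xi k))^-1 *: mseq xi k).
Proof.
rewrite scalerA mulrN scaleNr /Defs.mseq /Defs.xseq /=.
by case: (traj xi k) => [[x y] m].
Qed.

(** Iteration [k.+1] uses the parameters of index [k], so the conventional initial values do not
    enter. The extrapolation from the new iterate is rewritten from the old one: [eta k] times
    [1 + (1 - gam k t) / gam k t] is [eta k / gam k t]. *)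
Lemma mseqS xi k : (forall t, gam k t != 0) ->
  mseq xi k.+1 = (1 - \sum_t theta k t) *: mseq xi k
    + \sum_t theta k t *: G (xseq xi k
        + (eta k / gam k t) *: (- (enorm (mseq xi k))^-1 *: mseq xi k)) (xi k.+1).
Proof.
move=> gam0; rewrite /Defs.mseq -[in LHS]/(traj xi k.+2).
(* Exactly one iteration is unfolded, so that [trajS] can rewrite the inner state. *)
have -> : traj xi k.+2 = let: (xk, xkm1, mkm1) := traj xi k.+1 in
  let: (mk, xk1) := sfom_step G eta gam theta k.+1 xk xkm1 mkm1 (xi k.+1) in
  (xk1, xk, mk) by [].
rewrite trajS /=; congr (_ + _); apply: eq_bigr => t _; congr (_ *: G _ _).
rewrite xseqS; move: (- _ *: _) => u; rewrite [_ + _ *: u - _]addrAC subrr add0r.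
rewrite scalerA -addrA -scalerDl; congr (_ + _ *: _).
by field; exact: gam0.
Qed.

End Trajectory.

Theorem theorem3p7 (R : realType) (n : nat) (d : measure_display)
  (Xi : measurableType d) (P : probability Xi R)
  (f : 'rV[R]_n -> R) (G : 'rV[R]_n -> Xi -> 'rV[R]_n)
  (flow L1 sigma Lp : R) (p : nat)
  (x0 : 'rV[R]_n) (eta : nat -> R) (gam theta : nat -> 'I_p.-1 -> R)
  (pk : nat -> R) :
  (* Assumption A *)
  (forall x, flow <= f x) ->
  0 < L1 ->
  (forall x y, enorm (grad f y - grad f x) <= L1 * enorm (y - x)) ->
  (forall x (i : 'I_n), P.-integrable setT (fun s => (G x s 0 i)%:E) /\
     (\int[P]_(s in setT) (G x s 0 i)%:E = (grad f x 0 i)%:E)%E) ->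
  0 < sigma ->
  (forall x, (\int[P]_(s in setT) ((enorm (G x s - grad f x)) ^+ 2)%:E
               <= (sigma ^+ 2)%:E)%E) ->
  (* Assumption B *)
  (2 <= p)%N ->
  Cp p f ->
  0 < Lp ->
  (forall (x y : 'rV[R]_n) (hs : seq 'rV[R]_n), seq.size hs = p ->
     (forall h, h \in hs -> enorm h <= 1) ->
     iter_dirder hs f y - iter_dirder hs f x <= Lp * enorm (y - x)) ->
  (* algorithm parameters *)
  (forall k, 0 < eta k) ->
  (forall k t, 0 < gam k t < 1) ->
  (forall k, 0 < \sum_(t < p.-1) theta k t < 1) ->
  (forall k (j : nat), (1 <= j <= p.-1)%N ->
     \sum_(t < p.-1) theta k t / gam k t ^+ j = 1) ->
  (forall k, 0 < pk k) ->
  (forall k, (1 - \sum_(t < p.-1) theta k t) * pk k.+1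
             <= (1 - (p.+1%:R)^-1 * \sum_(t < p.-1) theta k t) * pk k) ->
  forall (xi : nat -> Xi) (k : nat),
    mseq G x0 eta gam theta xi k != 0 ->
    let xk := xseq G x0 eta gam theta xi k in
    let mk := mseq G x0 eta gam theta xi k in
    let Pk := f xk + pk k * enorm (mk - grad f xk) ^+ 2 in
    let Th := \sum_(t < p.-1) theta k t in
    (\int[P]_(s in setT)
        (f (xseq G x0 eta gam theta (path_upd xi k.+1 s) k.+1)
         + pk k.+1 * enorm (mseq G x0 eta gam theta (path_upd xi k.+1 s) k.+1
                            - grad f (xseq G x0 eta gam theta (path_upd xi k.+1 s) k.+1))
                     ^+ 2)%:E
     <= (Pk - eta k * enorm (grad f xk) + L1 / 2 * eta k ^+ 2
         + p.+1%:R * eta k ^+ 2 / (pk k * Th)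
         + p%:R * Lp ^+ 2 * eta k ^+ (2 * p) * pk k.+1 / ((p`!)%:R ^+ 2 * Th)
           * (1 + \sum_(t < p.-1) theta k t ^+ 2 / gam k t ^+ (2 * p))
         + p.-1%:R * sigma ^+ 2 * pk k.+1 * \sum_(t < p.-1) theta k t ^+ 2)%:E)%E.

Proof.
move=> _ _ gradL Gmean _ Gvar p2 fCp Lp0 fLp eta0 gam01 Th01 moment pk0 pkS xi k m0 /=.
set x := xseq G x0 eta gam theta xi k; set m := mseq G x0 eta gam theta xi k.
set T := \sum_(t < p.-1) theta k t.
have pE : p.-1.+1 = p by rewrite prednK // (leq_trans _ p2).
have gam0 t : 0 < gam k t by have /andP[] := gam01 k t.
have gamN0 t : gam k t != 0 by rewrite gt_eqF.
have df := Cp_differentiable p2 fCp.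
have nm0 : 0 < enorm m by rewrite lt_neqAle enorm_ge0 eq_sym enorm_eq0 m0.
pose v := - (enorm m)^-1 *: m.
have v1 : enorm v = 1.
  by rewrite enormZ normrN ger0_norm ?invr_ge0 ?mulVf ?gt_eqF // ltW.
pose x' := x + eta k *: v.
pose z t := x + (eta k / gam k t) *: v.
pose e := m - grad f x.
pose D := (1 - T) *: grad f x + \sum_t theta k t *: grad f (z t) - grad f x'.
pose w t s := G (z t) s - grad f (z t).
have xE s : xseq G x0 eta gam theta (path_upd xi k.+1 s) k.+1 = x'.
  by rewrite xseq_path_upd // xseqS.
(* The new momentum error splits into a part independent of [s] and the centred noise. *)
have errE s : mseq G x0 eta gam theta (path_upd xi k.+1 s) k.+1 - grad f x'
    = ((1 - T) *: e + D) + \sum_t theta k t *: w t s.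
  rewrite mseqS // mseq_path_upd // xseq_path_upd // {1}/path_upd eqxx.
  rewrite -/x -/m -/v -/T /w.
  under [X in _ = _ + X]eq_bigr do rewrite scalerBr.
  rewrite sumrB /e /D scalerBr.
  set S := \sum_(t < _) _ *: grad _ _; set S' := \sum_(t < _) _.
  by apply/rowP => i; rewrite !mxE; ring.
under eq_integral do rewrite xE errE.
have wi t i : P.-integrable setT (EFin \o (fun s => w t s 0 i)).
  have -> : (fun s => w t s 0 i) = (fun s => G (z t) s 0 i + - grad f (z t) 0 i).
    by apply/funext => s; rewrite !mxE.
  by apply: intbleD; [exact: (Gmean _ _).1 | exact: intble_cst].
have w0 t i : (\int[P]_(s in setT) (w t s 0 i)%:E = 0)%E.
  rewrite integral_EFin //; congr EFin.
  have -> : (fun s => w t s 0 i) = (fun s => G (z t) s 0 i + - grad f (z t) 0 i).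
    by apply/funext => s; rewrite !mxE.
  rewrite RintegralD //; [|exact: (Gmean _ _).1|exact: intble_cst].
  by rewrite Rintegral_probability_cst /Rintegral (Gmean _ _).2 subrr.
have noise := noise_second_moment (theta k) ((1 - T) *: e + D) (f x') wi w0
  (fun t => Gvar (z t)) (ltW (pk0 k.+1)).
apply: le_trans noise _.
rewrite lee_fin.
(* The bias bound is squared; [sqr_add1_sum_le] with [p.-1] terms turns the squared sum into a sum
   of squares. *)
have Dle : enorm D ^+ 2 <= p%:R * Lp ^+ 2 * eta k ^+ (2 * p) / p`!%:R ^+ 2
    * (1 + \sum_(t < p.-1) theta k t ^+ 2 / gam k t ^+ (2 * p)).
  have := extrapolated_gradient_bias p2 fCp fLp x pE (ltW Lp0) v1
    (eta0 k) gam0 (moment k).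
  rewrite -/T -/x' -/D => bias.
  have := sqr_add1_sum_le (fun t => `|theta k t| / gam k t ^+ p).
  rewrite pE; under [X in _ * (1 + X)]eq_bigr do
    rewrite expr_div_n real_normK ?num_real // -exprM mulnC.
  set S1 := \sum_t _; set S2 := \sum_t _ => S12.
  rewrite (@le_trans _ _ ((Lp / p`!%:R * eta k ^+ p * (1 + S1)) ^+ 2)) //.
    by rewrite ler_pXn2r ?nnegrE ?enorm_ge0 // (le_trans (enorm_ge0 _) bias).
  rewrite exprMn (le_trans (ler_wpM2l (sqr_ge0 _) S12)) //.
  rewrite exprMn expr_div_n -exprM mulnC le_eqVlt; apply/orP; left; apply/eqP.
  by field; rewrite pnatr_eq0 -lt0n fact_gt0.
have descent := normalized_step_descent x df gradL m0 (ltW (eta0 k)).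
rewrite -/v -/x' -/e in descent.
have /andP[T0 T1] := Th01 k; rewrite -/T in T0 T1.
have convex := enorm_sqr_convex e D (Th01 k); rewrite -/T in convex.
have := pkS k; rewrite -/T => pkST.
(* [A] is the coefficient of [enorm e ^+ 2] that the condition on [pk] leaves free. As the Young
   weight it produces exactly the term [p.+1%:R * eta k ^+ 2 / (pk k * T)]. *)
pose A := pk k * T / p.+1%:R.
have A0 : 0 < A by rewrite divr_gt0 ?mulr_gt0.
have young : 2 * eta k * enorm e <= A * enorm e ^+ 2 + p.+1%:R * eta k ^+ 2 / (pk k * T).
  have -> : p.+1%:R * eta k ^+ 2 / (pk k * T) = eta k ^+ 2 / A.
    by rewrite /A; field; rewrite !gt_eqF // ltr0Sn.
  rewrite -subr_ge0.
  have -> : A * enorm e ^+ 2 + eta k ^+ 2 / A - 2 * eta k * enorm e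
    = (A * enorm e - eta k) ^+ 2 / A by field; rewrite gt_eqF.
  by rewrite divr_ge0 ?sqr_ge0 // ltW.
(* Convexity gives the coefficient [(1 - T) * pk k.+1], which [pkST] trades for one in terms of
   [pk k]. *)
have step1 : pk k.+1 * enorm ((1 - T) *: e + D) ^+ 2
    <= (1 - p.+1%:R^-1 * T) * pk k * enorm e ^+ 2 + pk k.+1 * (enorm D ^+ 2 / T).
  apply: le_trans (ler_wpM2l (ltW (pk0 _)) convex) _.
  by rewrite mulrDr lerD2r mulrA [pk _ * _]mulrC ler_wpM2r ?sqr_ge0.
have step2 : pk k.+1 * (enorm D ^+ 2 / T)
    <= p%:R * Lp ^+ 2 * eta k ^+ (2 * p) * pk k.+1 / (p`!%:R ^+ 2 * T)
       * (1 + \sum_(t < p.-1) theta k t ^+ 2 / gam k t ^+ (2 * p)).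
  apply: le_trans (ler_wpM2l (ltW (pk0 _)) (ler_wpM2r _ Dle)) _.
    by rewrite invr_ge0 ltW.
  rewrite le_eqVlt; apply/orP; left; apply/eqP.
  by field; rewrite pnatr_eq0 -lt0n fact_gt0 gt_eqF.
have AE : (1 - p.+1%:R^-1 * T) * pk k * enorm e ^+ 2
    = pk k * enorm e ^+ 2 - A * enorm e ^+ 2.
  by rewrite /A; ring.
have noiseE : pk k.+1 * (p.-1%:R * sigma ^+ 2 * \sum_(t < p.-1) theta k t ^+ 2)
  = p.-1%:R * sigma ^+ 2 * pk k.+1 * \sum_(t < p.-1) theta k t ^+ 2 by ring.
rewrite -/e [pk k.+1 * (_ + _)]mulrDr noiseE addrA lerD2r.
rewrite AE in step1; move: young step1 step2 descent.
(* With the bulky terms abstracted, the goal is a linear combination of the four inequalities;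
   [A * enorm e ^+ 2] cancels between [young] and [step1]. *)
move: (_ / (p`!%:R ^+ 2 * T) * _) (_ / (pk k * T)) (A * _) => a b c; lra.
Qed.
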